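(* Let $G$ be a non-trivial finite group and let $P$ be a finite free $G$-poset. Then $$\operatorname{ind}_G |\Delta(P)| + |G| \le \chi(C_P).$$
   Context: $e$ denotes the identity of $G$. A $G$-poset is a partially ordered set $P$ with an action of $G$ on its elements preserving the order ($x<y \Rightarrow g\cdot x<g\cdot y$); it is free if $g\cdot x=x$ implies $g=e$. The order complex $\Delta(P)$ is the simplicial complex whose vertices are the elements of $P$ and whose simplices are the chains of $P$; $|\Delta(P)|$ is its geometric realization, which is a $G$-space under the induced action. The compatibility graph $C_P$ has vertex set $P$, with $x,y$ adjacent if there is $g\in G\setminus\{e\}$ such that $x$ and $g\cdot y$ are comparable in $P$ (for free $P$ this graph has no loops); $\chi$ denotes the chromatic number. For an integer $n\ge 0$, an $\mathbb{E}_nG$ space is the geometric realization of an $(n-1)$-connected free $n$-dimensional simplicial $G$-complex (a simplicial complex with a $G$-action on vertices taking simplices to simplices, whose induced action on the realization is free). For a $G$-space $X$, $\operatorname{ind}_G X=\min\{n : \text{there is a continuous } G\text{-equivariant map } X\to \mathbb{E}_nG\}$ (this is independent of the choice of $\mathbb{E}_nG$ space).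
   Formalization: The poset P is assumed to be nonempty: for empty P the index, being a minimum over integers n ≥ 0, is 0 and the chromatic number is 0, so the stated inequality would read |G| ≤ 0, which is false. *)

(* Defs.v *)
From HB Require Import structures.
From mathcomp Require Import all_boot all_order all_algebra all_fingroup finmap.
From mathcomp Require Import all_classical all_reals all_analysis.

Set Implicit Arguments.
Unset Strict Implicit.
Unset Printing Implicit Defensive.

Import Order.TTheory GRing.Theory Num.Theory numFieldNormedType.Exports.
Local Open Scope classical_set_scope.
Local Open Scope ring_scope.

(* Group actions are MathComp's right actions: a left action g . x is the
   right action to x g := g^-1 . x.  Every notion below quantifies over all g
   (or all g != 1), so it does not depend on this choice of side. *)
Definition free_action (gT : finGroupType) (T : Type)
    (to : {action gT &-> T}) : Prop :=
  forall (x : T) (g : gT), to x g = x -> g = 1%g.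

Lemma total_actM (gT : finGroupType) (T : Type) (to : {action gT &-> T}) x :
  act_morph to x.
Proof. by case: to => f [/= _ fM] g h; apply: fM; rewrite finset.in_setT. Qed.

Lemma total_act_inj (gT : finGroupType) (T : Type)
  (to : {action gT &-> T}) g : injective (to^~ g).
Proof. by case: to => f [/= fI _]; exact: fI. Qed.

Lemma total_act1 (gT : finGroupType) (T : Type) (to : {action gT &-> T}) x :
  to x 1%g = x.
Proof. by apply: (@total_act_inj _ _ to 1%g); rewrite -total_actM mulg1. Qed.

Lemma total_actK (gT : finGroupType) (T : Type) (to : {action gT &-> T}) g :
  cancel (to^~ g) (to^~ g^-1%g).
Proof. by move=> x; rewrite -total_actM mulgV total_act1. Qed.

Lemma total_actKV (gT : finGroupType) (T : Type) (to : {action gT &-> T}) g :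
  cancel (to^~ g^-1%g) (to^~ g).
Proof. by move=> x; rewrite -total_actM mulVg total_act1. Qed.

Record Gspace (gT : finGroupType) : Type := MkGspace {
  space_sort :> topologicalType;
  space_act : {action gT &-> space_sort};
  space_act_continuous :
    forall g : gT, continuous (fun x : space_sort => space_act x g)
}.

Definition G_map (gT : finGroupType) (X Y : Gspace gT) (f : X -> Y) : Prop :=
  continuous f /\
  forall (x : X) (g : gT), f (space_act X x g) = space_act Y (f x) g.

Record simplicial_complex : Type := MkSimplicialComplex {
  vertex : choiceType;
  simplex : set {fset vertex};
  simplex_neq0 : forall s, simplex s -> s != fset0;
  simplex_sub : forall s t : {fset vertex},
    simplex s -> fsubset t s -> t != fset0 -> simplex t;
  simplex_vertex : forall v : vertex, simplex [fset v]%fset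
}.

Definition has_dimension (K : simplicial_complex) (n : nat) : Prop :=
  (exists2 s : {fset vertex K}, simplex s & #|` s| = n.+1) /\
  (forall s : {fset vertex K}, simplex s -> (#|` s| <= n.+1)%N).

(* Barycentric coordinates of a point of the closed simplex spanned by s. *)
Definition in_simplex (R : realType) (V : choiceType) (s : {fset V})
    (x : V -> R) : Prop :=
  [/\ forall v, 0 <= x v,
      forall v, v \notin s -> x v = 0
    & \sum_(v <- s) x v = 1].

Record realization (R : realType) (K : simplicial_complex) : Type :=
  MkRealization {
    coord :> vertex K -> R;
    coordP : exists2 s : {fset vertex K}, simplex s & in_simplex s coord
  }.

Lemma realization_eq (R : realType) (K : simplicial_complex)
  (x y : realization R K) : coord x = coord y -> x = y.
Proof.
case: x y => [x px] [y py] /= exy; move: px; rewrite exy => px.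
by congr MkRealization; exact: Prop_irrelevance.
Qed.

(* The weak topology: U is open iff its trace on each closed simplex s is open
   for the Euclidean topology of s, given by the sup metric on coordinates. *)
Definition realization_open (R : realType) (K : simplicial_complex)
    (U : set (realization R K)) : Prop :=
  forall (s : {fset vertex K}) (x : realization R K),
    simplex s -> in_simplex s x -> U x ->
    exists2 e : R, 0 < e &
      forall y : realization R K, in_simplex s y ->
        (forall v, v \in s -> `|x v - y v| < e) -> U y.

Section RealizationTopology.
Variables (R : realType) (K : simplicial_complex).

HB.instance Definition _ := gen_eqMixin (realization R K).
HB.instance Definition _ := gen_choiceMixin (realization R K).

Let open_setT : realization_open [set: realization R K].
Proof. by move=> s x _ _ _; exists 1. Qed.

Let open_setI : setI_closed (@realization_open R K).
Proof.
move=> A B oA oB s x Ks sx [Ax Bx].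
have [e e0 eA] := oA _ _ Ks sx Ax; have [d d0 dB] := oB _ _ Ks sx Bx.
exists (Num.min e d); first by rewrite lt_min e0 d0.
move=> y sy xy; split.
  by apply: eA => // v /xy; rewrite lt_min => /andP[].
by apply: dB => // v /xy; rewrite lt_min => /andP[].
Qed.

Let open_bigcup (I : Type) (f : I -> set (realization R K)) :
  (forall i, realization_open (f i)) -> realization_open (\bigcup_i f i).
Proof.
move=> of_ s x Ks sx [i _ fx]; have [e e0 ef] := of_ i _ _ Ks sx fx.
by exists e => // y sy xy; exists i => //; apply: ef.
Qed.

HB.instance Definition _ := isOpenTopological.Build (realization R K)
  open_setT open_setI open_bigcup.

Lemma realization_openE (U : set (realization R K)) :
  open U <-> realization_open U.
Proof. by []. Qed.

End RealizationTopology.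

Record simplicial_Gcomplex (gT : finGroupType) : Type :=
  MkSimplicialGcomplex {
    Gcomplex :> simplicial_complex;
    vertex_act : {action gT &-> vertex Gcomplex};
    vertex_act_simplex : forall (g : gT) (s : {fset vertex Gcomplex}),
      simplex s -> simplex [fset vertex_act v g | v in s]%fset
  }.

Section RealizationAction.
Variables (R : realType) (gT : finGroupType) (K : simplicial_Gcomplex gT).

Definition coord_act (x : vertex K -> R) (g : gT) : vertex K -> R :=
  fun v => x (vertex_act K v g^-1%g).

Lemma coord_act_simplex (s : {fset vertex K}) (x : vertex K -> R) (g : gT) :
  in_simplex s x ->
  in_simplex [fset vertex_act K v g | v in s]%fset (coord_act x g).
Proof.
move=> [x0 xs sx]; split=> [v|v|]; first exact: x0.
- move=> vs; apply: xs; apply: contra vs => vs; apply/imfsetP.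
  by exists (vertex_act K v g^-1%g) => //; rewrite total_actKV.
- rewrite big_imfset /=; last by move=> u v _ _; exact: total_act_inj.
  by rewrite -sx; apply: eq_bigr => v _; rewrite /coord_act total_actK.
Qed.

Lemma coord_actP (x : realization R K) (g : gT) :
  exists2 s : {fset vertex K}, simplex s & in_simplex s (coord_act x g).
Proof.
have [s Ks sx] := coordP x.
exists [fset vertex_act K v g | v in s]%fset; first exact: vertex_act_simplex.
exact: coord_act_simplex.
Qed.

Definition realization_act_fun (x : realization R K) (g : gT) :
  realization R K := MkRealization (coord_actP x g).

Lemma realization_act1 (x : realization R K) : realization_act_fun x 1%g = x.
Proof.
by apply: realization_eq; apply: funext => v; rewrite /= /coord_act invg1 total_act1.
Qed.

Lemma realization_actM (x : realization R K) :
  act_morph realization_act_fun x.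
Proof.
move=> g h; apply: realization_eq; apply: funext => v.
by rewrite /= /coord_act invMg total_actM.
Qed.

Definition realization_act : {action gT &-> realization R K} :=
  TotalAction realization_act1 realization_actM.

Lemma realization_act_continuous (g : gT) :
  continuous (fun x : realization R K => realization_act x g).
Proof.
apply/continuousP => U /realization_openE oU; apply/realization_openE.
move=> s x Ks sx Ux.
have [e e0 eU] :=
  oU _ (realization_act x g) (vertex_act_simplex g Ks) (coord_act_simplex g sx) Ux.
exists e => // y sy xy; apply: eU; first exact: coord_act_simplex.
by move=> _ /imfsetP[v vs ->]; rewrite /= /coord_act total_actK; exact: xy.
Qed.

Definition realization_Gspace : Gspace gT :=
  MkGspace realization_act_continuous.

End RealizationAction.

Definition unit_sphere (R : realType) (m : nat) : set 'rV[R]_m :=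
  [set x | \sum_(i < m) x 0 i ^+ 2 = 1].

Definition unit_ball (R : realType) (m : nat) : set 'rV[R]_m :=
  [set x | \sum_(i < m) x 0 i ^+ 2 <= 1].

(* X is (n-1)-connected: for -1 <= k <= n-1, every continuous map S^k -> X
   extends continuously to the ball B^(k+1).  The case k = -1 says that X is
   nonempty, after which maps on S^k may be taken to be total functions that are
   continuous on S^k.  The index is shifted so that n = 0 makes sense. *)
Definition pred_connected (R : realType) (n : nat) (X : topologicalType) :
    Prop :=
  inhabited X /\
  forall k : nat, (k < n)%N ->
  forall f : 'rV[R]_k.+1 -> X,
    {within @unit_sphere R k.+1, continuous f} ->
    exists2 h : 'rV[R]_k.+1 -> X,
      {within @unit_ball R k.+1, continuous h} &
      forall x, unit_sphere x -> h x = f x.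

Record EG_space (R : realType) (gT : finGroupType) (n : nat) : Type :=
  MkEGspace {
    EG_complex : simplicial_Gcomplex gT;
    EG_free : free_action (realization_act R EG_complex);
    EG_dimension : has_dimension EG_complex n;
    EG_connected : pred_connected R n (realization R EG_complex)
  }.

Definition EG_Gspace (R : realType) (gT : finGroupType) (n : nat)
  (E : EG_space R gT n) : Gspace gT := realization_Gspace R (EG_complex E).

(* ind_G X = n, computed with the choice E n of an E_n G space for each n. *)
Definition is_G_index (R : realType) (gT : finGroupType)
    (E : forall n, EG_space R gT n) (X : Gspace gT) (n : nat) : Prop :=
  (exists f : X -> EG_Gspace (E n), G_map f) /\
  forall m : nat, (exists f : X -> EG_Gspace (E m), G_map f) -> (n <= m)%N.

Section OrderComplex.
Variables (d : Order.disp_t) (P : finPOrderType d).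

Definition chain : set {fset P} :=
  [set s | s != fset0 /\ {in s &, forall x y : P, (x >=< y)%O}].

Lemma chain_neq0 (s : {fset P}) : chain s -> s != fset0.
Proof. by case. Qed.

Lemma chain_sub (s t : {fset P}) :
  chain s -> fsubset t s -> t != fset0 -> chain t.
Proof.
by move=> [_ cs] /fsubsetP ts t0; split=> // x y /ts xs /ts ys; apply: cs.
Qed.

Lemma chain_vertex (x : P) : chain [fset x]%fset.
Proof.
split; first by apply/fset0Pn; exists x; rewrite inE.
by move=> y z; rewrite !inE => /eqP -> /eqP ->; exact: comparablexx.
Qed.

Definition order_complex : simplicial_complex :=
  MkSimplicialComplex chain_neq0 chain_sub chain_vertex.

Variables (gT : finGroupType) (to : {action gT &-> P}).

Definition order_preserving : Prop :=
  forall (g : gT) (x y : P), (x < y)%O -> (to x g < to y g)%O.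

Lemma order_preserving_comparable (toP : order_preserving) (g : gT) (x y : P) :
  (x >=< y)%O -> (to x g >=< to y g)%O.
Proof.
have le_to u v : (u <= v)%O -> (to u g <= to v g)%O.
  by rewrite le_eqVlt => /predU1P[-> //|/(toP g)/ltW].
by move=> /orP[] /le_to h; apply/orP; [left | right].
Qed.

Lemma chain_act (toP : order_preserving) (g : gT) (s : {fset P}) :
  chain s -> chain [fset to v g | v in s]%fset.
Proof.
move=> [s0 cs]; split.
  by case/fset0Pn: s0 => x xs; apply/fset0Pn; exists (to x g); exact: in_imfset.
move=> _ _ /imfsetP[x xs ->] /imfsetP[y ys ->].
by apply: order_preserving_comparable => //; apply: cs.
Qed.

Definition order_Gcomplex (toP : order_preserving) : simplicial_Gcomplex gT :=
  @MkSimplicialGcomplex gT order_complex to (chain_act toP).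

(* Comparability is reflexive: distinct elements of one orbit are adjacent. *)
Definition compat_graph : rel P :=
  fun x y => [exists g : gT, (g != 1%g) && (x >=< to y g)%O].

End OrderComplex.

Definition colorable (T : finType) (e : rel T) (k : nat) : bool :=
  [exists c : {ffun T -> 'I_k},
    [forall x, forall y, e x y ==> (c x != c y)]].

(* The least k such that e is k-colorable; if e has no loop then #|T| colors
   suffice, so the search succeeds. *)
Definition chromatic_number (T : finType) (e : rel T) : nat :=
  find (colorable e) (iota 0 #|T|.+1).

Lemma chromatic_number_le (T : finType) (e : rel T) (k : nat) :
  (k <= #|T|)%N -> colorable e k -> (chromatic_number e <= k)%N.
Proof.
move=> kT ek; rewrite leqNgt; apply/negP => /(before_find 0%N).
by rewrite nth_iota ?ltnS // add0n ek.
Qed.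

Lemma colorable_card (T : finType) (e : rel T) :
  irreflexive e -> colorable e #|T|.
Proof.
move=> ei; apply/existsP; exists [ffun x => enum_rank x].
apply/forallP => x; apply/forallP => y; apply/implyP => exy; rewrite !ffunE.
apply: contraTneq exy => /enum_rank_inj ->; by rewrite ei.
Qed.

Lemma chromatic_number_colorable (T : finType) (e : rel T) :
  irreflexive e -> colorable e (chromatic_number e).
Proof.
move=> /colorable_card eT.
have h : has (colorable e) (iota 0 #|T|.+1).
  by apply/hasP; exists #|T| => //; rewrite mem_iota leq0n add0n ltnSn.
move: (nth_find 0%N h); rewrite nth_iota ?add0n //.
by move: h; rewrite has_find size_iota.
Qed.

Lemma compat_graph_irreflexive (d : Order.disp_t) (P : finPOrderType d)
    (gT : finGroupType) (to : {action gT &-> P}) :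
  order_preserving to -> free_action to -> irreflexive (compat_graph to).
Proof.
move=> toP toF x; apply/existsP => -[g /andP[g1 xgx]].
have iterE n : to x (g ^+ n)%g = iter n (to^~ g) x.
  by elim: n => [|n IH]; rewrite ?total_act1 //= expgSr total_actM IH.
have gx := iterE #[g]%g; rewrite expg_order total_act1 in gx.
have ne : to x g != x by apply: contraNneq g1 => /toF ->.
have [m om] : exists m, (#[g]%g = m.+1)%N.
  by exists (#[g]%g).-1; rewrite prednK // order_gt0.
rewrite om in gx; case/orP: xgx => le.
- have lt : (x < to x g)%O by rewrite lt_neqAle eq_sym ne.
  suff : (x < iter m.+1 (to^~ g) x)%O by rewrite -gx ltxx.
  by elim: {om gx} m => [//|m IH]; apply: lt_trans lt _; exact: toP.
- have lt : (to x g < x)%O by rewrite lt_neqAle ne.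
  suff : (iter m.+1 (to^~ g) x < x)%O by rewrite -gx ltxx.
  by elim: {om gx} m => [//|m IH]; apply: lt_trans lt; exact: toP.
Qed.

(* Main.v *)
(* A proper coloring c of C_P with k colors sends a point x of |Delta(P)| to the
   weights w_(g,i) = sum of x_p over the p for which the translate of p by g^-1
   has color i.  For each g these weights sum to 1, and since comparable
   translates have different colors, no color carries weight for two distinct g.
   So w lies in the deleted product of simplices: the polyhedral complex whose
   cells are products over g of simplices on pairwise disjoint nonempty sets of
   colors.  Such a cell has dimension at most k - |G|, and G permutes the cells
   freely, so an equivariant map from the complex to an E_(k-|G|) G space can be
   built cell by cell, choosing one cell in each orbit. *)
Require Import Defs.
From mathcomp Require Import all_boot all_order all_algebra all_fingroup finmap.
From mathcomp Require Import all_classical all_reals all_analysis.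
Set Implicit Arguments.
Unset Strict Implicit.
Unset Printing Implicit Defensive.

Import Order.TTheory GRing.Theory Num.Theory numFieldNormedType.Exports.
Local Open Scope classical_set_scope.
Local Open Scope ring_scope.

(** * Continuity on subsets *)

Lemma within_continuous_comp (T U W : topologicalType) (A : set T) (B : set U)
    (g : T -> U) (f : U -> W) :
  (forall x, A x -> B (g x)) -> {within A, continuous g} ->
  {within B, continuous f} -> {within A, continuous (f \o g)}.
Proof.
move=> AB /subspace_continuousP gc /subspace_continuousP fc.
apply/subspace_continuousP => x Ax Q /(fc _ (AB _ Ax)) fQ.
have := gc _ Ax _ fQ; rewrite /nbhs /= /within /=.
by apply: filterS => y yQ Ay; apply: yQ => //; exact: AB.
Qed.

Lemma within_continuous_eq (T U : topologicalType) (A : set T) (f g : T -> U) :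
  (forall x, A x -> f x = g x) -> {within A, continuous f} ->
  {within A, continuous g}.
Proof.
move=> fg /subspace_continuousP fc; apply/subspace_continuousP => x Ax Q gQ.
have /(fc x Ax) : nbhs (f x) Q by rewrite (fg x Ax).
rewrite /nbhs /= /within /=.
apply: filterS => y yQ Ay; have Qfy : Q (f y) := yQ Ay.
by rewrite (fg y Ay) in Qfy.
Qed.

(** The pasting lemma for finitely many closed sets, by induction on the list. *)
Lemma within_continuous_bigsetU (T U : topologicalType) (I : eqType)
    (r : seq I) (A : I -> set T) (f : T -> U) :
  (forall i, closed (A i)) -> {in r, forall i, {within A i, continuous f}} ->
  {within \big[setU/set0]_(i <- r) A i, continuous f}.
Proof.
move=> cA; elim: r => [|i r IH] fc.
  by rewrite big_nil; exact: continuous_subspace0.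
rewrite big_cons; apply: withinU_continuous => //.
- exact: closed_bigsetU.
- by apply: fc; rewrite inE eqxx.
- by apply: IH => j jr; apply: fc; rewrite inE jr orbT.
Qed.

Lemma continuous_rV (R : realType) (T : topologicalType) (n : nat)
    (f : T -> 'rV[R]_n) (F : 'I_n -> T -> R) :
  (forall j y, f y 0 j = F j y) -> (forall j, continuous (F j)) ->
  continuous f.
Proof.
move=> fF Fc x Q [P lP PQ].
have : \forall y \near x, forall j, P 0 j (F j y).
  by apply: filter_forall => j; apply: (Fc j x); rewrite -fF; exact: lP.
by apply: filterS => y Py; apply: PQ => i j; rewrite ord1 fF.
Qed.

Lemma continuous_sumr (R : realType) (T : topologicalType) (I : Type)
    (r : seq I) (P : pred I) (f : I -> T -> R) :
  (forall i, P i -> continuous (f i)) ->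
  continuous (fun x => \sum_(i <- r | P i) f i x).
Proof. by move=> fc; apply: continuous_big => //; exact: add_continuous. Qed.

(** * Extension over convex bodies *)

Section Gauge.
Variables (R : realType) (d : nat).
Implicit Types (z : 'rV[R]_d) (N : 'rV[R]_d -> R).

Definition euclid z : R := Num.sqrt (\sum_i z 0 i ^+ 2).

Lemma euclid_continuous : continuous euclid.
Proof.
move=> z; apply: continuous_comp; last exact: sqrt_continuous.
apply: (@continuous_sumr R 'rV[R]_d 'I_d _ _ (fun i z => z 0 i ^+ 2)) => i _ x.
apply: (@continuous_comp _ _ _ (fun z : 'rV[R]_d => z 0 i) (fun t : R => t ^+ 2)).
  exact: coord_continuous.
exact: exprn_continuous.
Qed.

Lemma sumr_sqr_ge0 z : 0 <= \sum_i z 0 i ^+ 2.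
Proof. by apply: sumr_ge0 => i _; exact: sqr_ge0. Qed.

Lemma euclid_eq0 z : (euclid z == 0) = (z == 0).
Proof.
rewrite sqrtr_eq0 le_eqVlt ltNge sumr_sqr_ge0 orbF psumr_eq0; last first.
  by move=> i _; exact: sqr_ge0.
apply/allP/eqP => [h|-> i _]; last by rewrite /= mxE expr0n /= eqxx.
apply/rowP => i; rewrite mxE; apply/eqP.
by have := h i (mem_index_enum _); rewrite /= sqrf_eq0.
Qed.

Lemma euclid_gt0 z : z != 0 -> 0 < euclid z.
Proof. by move=> z0; rewrite lt_def euclid_eq0 z0 sqrtr_ge0. Qed.

Lemma euclidZ (c : R) z : 0 <= c -> euclid (c *: z) = c * euclid z.
Proof.
move=> c0; rewrite /euclid.
rewrite (eq_bigr (fun i => c ^+ 2 * z 0 i ^+ 2)) => [|i _]; last first.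
  by rewrite mxE exprMn.
by rewrite -mulr_sumr sqrtrM ?sqr_ge0// sqrtr_sqr ger0_norm.
Qed.

Lemma coord_le_euclid z i : `|z 0 i| <= euclid z.
Proof.
rewrite -sqrtr_sqr ler_sqrt ?sumr_sqr_ge0// (bigD1 i)//= lerDl.
by apply: sumr_ge0 => j _; exact: sqr_ge0.
Qed.

Lemma sqr_euclid z : euclid z ^+ 2 = \sum_i z 0 i ^+ 2.
Proof. by rewrite sqr_sqrtr ?sumr_sqr_ge0. Qed.

Lemma unit_sphereE z : unit_sphere z <-> euclid z = 1.
Proof.
rewrite /unit_sphere /= -sqr_euclid; split => [/eqP|->]; last by rewrite expr1n.
by rewrite sqrp_eq1 ?sqrtr_ge0// => /eqP.
Qed.

Lemma unit_ballE z : unit_ball z <-> euclid z <= 1.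
Proof.
rewrite /unit_ball /= -sqr_euclid -[leRHS](expr1n _ 2).
by rewrite ler_sqr ?nnegrE ?sqrtr_ge0.
Qed.

(** For a positive gauge [N], each point moves along its ray to Euclidean norm [N z], so level sets
    of [N] become round spheres. *)
Definition radial N z : 'rV[R]_d := (N z / euclid z) *: z.

Lemma radialE N j z : radial N z 0 j = N z / euclid z * z 0 j.
Proof. by rewrite /radial mxE. Qed.

(** Only the origin needs care: since [|z_j| <= euclid z], each coordinate of the image is bounded
    by [|N z|], which tends to 0. *)
Lemma radial_continuous N : continuous N -> N 0 = 0 -> continuous (radial N).
Proof.
move=> cN N0; apply: (continuous_rV (radialE N)) => j z; rewrite /continuous_at.
have [->|z0] := eqVneq z 0.
  rewrite mxE mulr0.
  apply/(@cvgr0Pnorm_lt _ _ _ _ (nbhs_filter (0 : 'rV[R]_d))) => e e0.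
  have /(@cvgr0Pnorm_lt _ _ _ _ (nbhs_filter _))/(_ e e0) :
      N x @[x --> (0 : 'rV[R]_d)] --> 0 by rewrite -[X in _ --> X]N0; exact: cN.
  apply: filterS => x; apply: le_lt_trans.
  rewrite -mulrA normrM ler_piMr// mulrC normrM normfV.
  have [->|x0] := eqVneq x 0; first by rewrite mxE normr0 mul0r.
  rewrite (ger0_norm (sqrtr_ge0 _)) ler_pdivrMr ?euclid_gt0// mul1r.
  exact: coord_le_euclid.
have ez0 : euclid z != 0 by rewrite euclid_eq0.
have cq := continuousM (@cN z) (continuousV ez0 (@euclid_continuous z)).
exact: (continuousM cq (@coord_continuous R 1 d 0 j z)).
Qed.

Lemma euclid_radial N z : N 0 = 0 -> (forall z, z != 0 -> 0 < N z) ->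
  euclid (radial N z) = N z.
Proof.
move=> N0 Npos; have [->|z0] := eqVneq z 0.
  by rewrite /radial scaler0 N0; apply/eqP; rewrite euclid_eq0.
rewrite /radial euclidZ ?divr_ge0 ?sqrtr_ge0 ?ltW ?Npos//.
by rewrite divfK // euclid_eq0.
Qed.

End Gauge.

(** The map [p] charts [C] into the region [N <= 1], and [e] inverts it over [B]. Radial rescaling
    turns this region into the Euclidean ball, where connectivity of [Y] extends the map transported
    from [B] to the sphere; pulling back gives [h]. *)
Lemma gauge_extension (R : realType) (Y : topologicalType) (n d : nat)
    (V : topologicalType) (C B : set V) (p : V -> 'rV[R]_d) (e : 'rV[R]_d -> V)
    (N : 'rV[R]_d -> R) (f : V -> Y) :
  pred_connected R n Y -> (d <= n)%N ->
  continuous p -> continuous e -> continuous N ->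
  (forall c z, 0 < c -> N (c *: z) = c * N z) ->
  (forall z, z != 0 -> 0 < N z) ->
  (forall w, C w -> N (p w) <= 1) ->
  (forall z, N z = 1 -> B (e z)) ->
  (forall w, B w -> N (p w) = 1 /\ e (p w) = w) ->
  {within B, continuous f} ->
  exists2 h : V -> Y, {within C, continuous h} & forall w, B w -> h w = f w.
Proof.
move=> [[y0] Yn] dn cp ce cN NZ Npos CN NB BN fc.
(* Homogeneity with factor 2 gives [N 0 = 2 * N 0]. *)
have N0 : N 0 = 0.
  have := NZ 2 0 (ltr0Sn _ _); rewrite scaler0 mulr_natl mulr2n => /eqP.
  by rewrite -subr_eq0 opprD addNKr oppr_eq0 => /eqP.
case: d p e N cp ce cN NZ Npos CN NB BN N0 dn =>
  [|k] p e N cp ce cN NZ Npos CN NB BN N0 dn.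
  (* In dimension 0 the only vector has gauge 0, so [B] is empty and any constant works. *)
  exists (fun=> y0); first by apply: continuous_subspaceT => x; exact: cvg_cst.
  move=> w /BN[+ _]; rewrite (_ : p w = 0) ?N0; last by apply/rowP => -[].
  by move/eqP; rewrite eq_sym oner_eq0.
(* [q] projects a ray to the level [N = 1] and then into [B]; on the unit sphere it undoes the
   rescaling. *)
pose q z := e ((N z)^-1 *: z).
have sphere_neq0 z : unit_sphere z -> z != 0.
  by move/unit_sphereE => z1; rewrite -euclid_eq0 z1 oner_eq0.
have qB z : z != 0 -> B (q z).
  by move=> z0; apply: NB; rewrite NZ ?invr_gt0 ?Npos// mulVf// gt_eqF ?Npos.
have [h0 h0c h0f] : exists2 h : 'rV[R]_k.+1 -> Y,
    {within @unit_ball R k.+1, continuous h} &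
    forall x, unit_sphere x -> h x = (f \o q) x.
  apply: Yn => //; apply: within_continuous_comp fc.
    by move=> z /sphere_neq0; exact: qB.
  apply/subspace_continuousP => z /sphere_neq0 z0; apply: cvg_within_filter.
  have Nz0 : N z != 0 by rewrite gt_eqF ?Npos.
  apply: continuous_comp; last exact: ce.
  exact: (@cvgZ _ _ _ _ (nbhs_filter z) _ id _ _ (continuousV Nz0 (@cN z)) cvg_id).
exists (h0 \o (radial N \o p)).
  apply: within_continuous_comp h0c.
    by move=> w Cw; apply/unit_ballE; rewrite /= euclid_radial // CN.
  apply: continuous_subspaceT => w; apply: continuous_comp; first exact: cp.
  exact: radial_continuous.
move=> w Bw; have [Nw ew] := BN _ Bw.
have r1 : euclid (radial N (p w)) = 1 by rewrite euclid_radial.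
rewrite /= h0f; last exact/unit_sphereE.
have pw0 : p w != 0.
  by apply/eqP => pw; move: Nw; rewrite pw N0 => /eqP; rewrite eq_sym oner_eq0.
rewrite /= /q /radial NZ ?divr_gt0 ?Nw ?euclid_gt0// mulr1 scalerA div1r.
by rewrite mulVf ?invr_eq0 ?euclid_eq0// scale1r ew.
Qed.

(** * Extension over products of simplices *)

Section ProductOfSimplices.
Variables (R : realType) (A I : finType) (blk : A -> I).
Implicit Types (w : 'rV[R]_#|A|) (S : {set A}).

Definition crd w (a : A) : R := w 0 (enum_rank a).

Definition of_crd (u : A -> R) : 'rV[R]_#|A| := \row_j u (enum_val j).

Lemma of_crdK u : crd (of_crd u) =1 u.
Proof. by move=> a; rewrite /crd mxE enum_rankK. Qed.

Lemma crd_inj w w' : crd w =1 crd w' -> w = w'.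
Proof. by move=> ww; apply/rowP => j; rewrite -(enum_valK j); exact: ww. Qed.

Lemma crd_continuous a : continuous (crd^~ a).
Proof. exact: coord_continuous. Qed.

Lemma of_crd_continuous (T : topologicalType) (u : T -> A -> R) :
  (forall a, continuous (u^~ a)) -> continuous (fun x => of_crd (u x)).
Proof.
move=> uc; apply: (@continuous_rV _ _ _ _ (fun j x => u x (enum_val j))) => //.
by move=> j x; rewrite mxE.
Qed.

(** The product over [i] of the simplices spanned by the part of [S] in block [i]; it is empty as
    soon as [S] misses a block. *)
Definition cell S : set 'rV[R]_#|A| :=
  [set w | [/\ forall a, 0 <= crd w a,
               forall i, \sum_(a | blk a == i) crd w a = 1
             & forall a, a \notin S -> crd w a = 0]].

Definition boundary S : set 'rV[R]_#|A| :=
  [set w | cell S w /\ exists2 a, a \in S & crd w a = 0].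

Lemma closed_eqr (T : topologicalType) (f : T -> R) (c : R) :
  continuous f -> closed [set x | f x = c].
Proof.
move=> fc; apply: (@preimage_closed _ _ f [set c]); last exact: closed_eq.
by move=> x _; exact: fc.
Qed.

Lemma closed_cell S : closed (cell S).
Proof.
rewrite (_ : cell S = (\bigcap_a [set w | 0 <= crd w a]) `&`
    (\bigcap_i [set w | \sum_(a | blk a == i) crd w a = 1]) `&`
    (\bigcap_(a in [set` ~: S]) [set w | crd w a = 0])); last first.
  apply/seteqP; split => w.
    move=> [w0 w1 wS]; split; first by split => ? _; [exact: w0 | exact: w1].
    by move=> a /=; rewrite inE; exact: wS.
  move=> [[w0 w1] wS]; split=> [a|i|a aS]; [exact: w0 | exact: w1 |].
  by apply: wS; rewrite /= inE.
apply: closedI; first apply: closedI.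
- apply: closed_bigI => a _.
  apply: (@preimage_closed _ _ (crd^~ a) [set x | 0 <= x]).
    by move=> x _; exact: crd_continuous.
  exact: closed_ge.
- apply: closed_bigI => i _; apply: closed_eqr.
  by apply: continuous_sumr => a _; exact: crd_continuous.
- by apply: closed_bigI => a _; apply: closed_eqr; exact: crd_continuous.
Qed.

Lemma cell_sub S S' w : S \subset S' -> cell S w -> cell S' w.
Proof.
move=> /fintype.subsetP SS' [w0 w1 wS]; split=> // a aS'; apply: wS.
by apply: contra aS'; exact: SS'.
Qed.

Lemma boundary_sub S w :
  boundary S w -> exists2 a, a \in S & cell (S :\ a) w.
Proof.
move=> [[w0 w1 wS] [a aS wa]]; exists a => //; split => // b.
by rewrite !inE negb_and negbK => /orP[/eqP ->|/wS].
Qed.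

(** * Affine coordinates and the gauge of a single cell *)

Section Coordinates.
Variables (S : {set A}) (b : 'rV[R]_#|A|) (r : I -> A).
Hypotheses (Sb : cell S b) (b_neq0 : forall a, a \in S -> crd b a != 0).
Hypotheses (rS : forall i, r i \in S) (rK : cancel r blk).

Let b_gt0 a : a \in S -> 0 < crd b a.
Proof. by case: Sb => b0 _ _ /b_neq0 ba; rewrite lt_def ba b0. Qed.

(** With one representative [r i] removed from each block, the number of remaining coordinates,
    [|S| - |I|], is the dimension of the cell. *)
Definition free_crd : {set A} := [set a in S | a \notin codom r].

Lemma card_free_crd : (#|free_crd| + #|I| = #|S|)%N.
Proof.
rewrite addnC -(card_codom (can_inj rK)) -(cardsID [set a in codom r] S).
congr (_ + _)%N; apply: eq_card => a; rewrite !inE.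
  rewrite andb_idl // => /codomP[i ->]; exact: rS.
by rewrite andbC.
Qed.

Local Notation ev := (fun j : 'I_#|free_crd| => (enum_val j : A)).

(* The linear map from the free coordinates to the tangent space of the cell:
   the representative of each block balances the other coordinates. *)
Definition tangent (z : 'rV[R]_#|free_crd|) (a : A) : R :=
  \sum_j z 0 j * ((ev j == a)%:R - (r (blk (ev j)) == a)%:R).

Lemma tangent_continuous a : continuous (tangent^~ a).
Proof.
apply: continuous_sumr => j _ z.
exact: (continuousM (@coord_continuous R 1 _ 0 j z) (@cst_continuous _ _ _ z)).
Qed.

Lemma tangentZ c z a : tangent (c *: z) a = c * tangent z a.
Proof.
by rewrite /tangent mulr_sumr; apply: eq_bigr => j _; rewrite mxE mulrA.
Qed.

Lemma sum_pred1 (P : pred A) (x : A) :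
  \sum_(a | P a) (x == a)%:R = (P x)%:R :> R.
Proof.
rewrite -natr_sum big_mkcond /= (bigD1 x) //= eqxx big1 ?addn0.
  by case: (P x).
by move=> a /negbTE ax; rewrite eq_sym ax; case: (P a).
Qed.

Lemma tangent_blk z i : \sum_(a | blk a == i) tangent z a = 0.
Proof.
rewrite exchange_big /= big1 // => j _.
by rewrite -mulr_sumr sumrB !sum_pred1 rK subrr mulr0.
Qed.

Lemma ev_free j : (ev j \in S) * (ev j \notin codom r).
Proof. by have := enum_valP j; rewrite inE => /andP[-> ->]. Qed.

Lemma tangent_supp z a : a \notin S -> tangent z a = 0.
Proof.
move=> aS; rewrite /tangent big1 // => j _.
rewrite !(negbTE (contraNneq _ aS)) ?subrr ?mulr0// => <-; first exact: rS.
by rewrite ev_free.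
Qed.

Lemma tangent_ev z j : tangent z (ev j) = z 0 j.
Proof.
have rj j' : (r (blk (ev j')) == ev j) = false.
  apply: contraNF (ev_free j).2 => /eqP <-; exact: codom_f.
rewrite /tangent (bigD1 j) //= eqxx rj subr0 mulr1 big1 ?addr0 // => j' j'j.
by rewrite rj (inj_eq enum_val_inj) (negbTE j'j) subrr mulr0.
Qed.

(** Tangent vectors are determined by their free coordinates: the zero sum of each block forces the
    entry at its representative. *)
Lemma blk_sum0_eq0 (u : A -> R) :
  (forall i, \sum_(a | blk a == i) u a = 0) -> (forall j, u (ev j) = 0) ->
  (forall a, a \notin S -> u a = 0) -> u =1 fun=> 0.
Proof.
move=> ui uj uS.
have ur a : a \notin codom r -> u a = 0.
  move=> ar; have [aS|/uS//] := boolP (a \in S).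
  have aD : a \in free_crd by rewrite inE aS.
  by rewrite -(enum_rankK_in aD aD) uj.
move=> a; have [/codomP[i ->]|/ur//] := boolP (a \in codom r).
have := ui i; rewrite (bigD1 (r i)) ?rK //= big1 ?addr0 // => c /andP[/eqP ci cr].
by apply: ur; apply: contra cr => /codomP[i' ci']; rewrite ci' -ci ci' rK.
Qed.

Definition local_crd w : 'rV[R]_#|free_crd| :=
  \row_j (crd w (ev j) - crd b (ev j)).

Lemma local_crd_continuous : continuous local_crd.
Proof.
apply: (@continuous_rV _ _ _ _ (fun j w => crd w (ev j) - crd b (ev j))).
  by move=> j w; rewrite mxE.
move=> j w.
exact: (continuousB (@crd_continuous (ev j) w) (@cst_continuous _ _ _ w)).
Qed.

Definition local_param z : 'rV[R]_#|A| :=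
  of_crd (fun a => crd b a + tangent z a).

Lemma local_param_continuous : continuous local_param.
Proof.
apply: of_crd_continuous => a z.
exact: (continuousD (@cst_continuous _ _ _ z) (@tangent_continuous a z)).
Qed.

Lemma tangent_local_crd w a :
  cell S w -> tangent (local_crd w) a = crd w a - crd b a.
Proof.
move=> [w0 w1 wS]; case: Sb => b0 b1 bS; apply/eqP; rewrite -subr_eq0; apply/eqP.
apply: (blk_sum0_eq0 (u := fun a => tangent (local_crd w) a - (crd w a - crd b a))).
- by move=> i; rewrite !sumrB tangent_blk w1 b1 !subrr.
- by move=> j; rewrite tangent_ev mxE subrr.
- by move=> c cS; rewrite tangent_supp // wS // bS // !subrr.
Qed.

Lemma local_crdK w : cell S w -> local_param (local_crd w) = w.
Proof.
move=> Sw; apply: crd_inj => a.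
by rewrite of_crdK tangent_local_crd // addrCA subrr addr0.
Qed.

(* The Minkowski gauge of the cell centred at its interior point b. *)
Definition gauge z : R :=
  \big[Num.max/0]_(a in S) (- tangent z a / crd b a).

Lemma gauge_ge z a : a \in S -> - tangent z a / crd b a <= gauge z.
Proof. by move=> aS; apply: le_bigmax_cond. Qed.

Lemma gauge_continuous : continuous gauge.
Proof.
apply: continuous_big => [|a _ z].
  exact: max_continuous.
apply: (continuousM _ (@cst_continuous _ _ _ z)).
exact: (continuousN (@tangent_continuous a z)).
Qed.

Lemma gaugeZ c z : 0 < c -> gauge (c *: z) = c * gauge z.
Proof.
move=> c0; rewrite /gauge.
rewrite (big_morph ( *%R c) (fun x y => maxr_pMr x y (ltW c0)) (mulr0 c)).
by apply: eq_bigr => a _; rewrite tangentZ -mulrN mulrA.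
Qed.

(** If the gauge were at most 0, all tangent coordinates would be nonnegative; as each block sums to
    0, they would all vanish. Geometrically, the cell contains no ray from [b]. *)
Lemma gauge_gt0 z : z != 0 -> 0 < gauge z.
Proof.
apply: contraNT; rewrite -leNgt => Nz.
have t0 a : 0 <= tangent z a.
  have [aS|/tangent_supp ->//] := boolP (a \in S).
  have := le_trans (gauge_ge z aS) Nz.
  by rewrite mulNr oppr_le0 pmulr_lge0 ?invr_gt0 ?b_gt0.
apply/eqP/rowP => j; rewrite mxE -tangent_ev.
have := tangent_blk z (blk (ev j)); move/eqP; rewrite psumr_eq0 //.
by move=> /allP/(_ (ev j) (mem_index_enum _)); rewrite /= eqxx /= => /eqP.
Qed.

Lemma gauge_cell w : cell S w -> gauge (local_crd w) <= 1.
Proof.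
move=> Sw; apply: bigmax_le => // a aS; rewrite tangent_local_crd //.
case: Sw => w0 _ _; rewrite ler_pdivrMr ?b_gt0 // mul1r opprB.
by rewrite gerBl.
Qed.

(** A coordinate that vanishes at [w] contributes the ratio 1, so the bound of [gauge_cell] is
    attained. *)
Lemma gauge_boundary w : boundary S w ->
  gauge (local_crd w) = 1 /\ local_param (local_crd w) = w.
Proof.
move=> [Sw [a aS wa]]; split; last exact: local_crdK.
apply/eqP; rewrite eq_le gauge_cell //=.
apply: le_trans (gauge_ge _ aS); rewrite tangent_local_crd // wa sub0r opprK.
by rewrite divff ?b_neq0.
Qed.

(** Gauge at most 1 says that no coordinate of [b] plus the tangent vector is negative; were they
    all positive on [S], the finite maximum would be below 1. *)
Lemma boundary_local_param z : gauge z = 1 -> boundary S (local_param z).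
Proof.
move=> Nz; case: Sb => b0 b1 bS.
have Sz : cell S (local_param z).
  split=> [a|i|a aS].
  - rewrite of_crdK; have [aS|aS] := boolP (a \in S); last first.
      by rewrite tangent_supp // bS // addr0.
    have := gauge_ge z aS; rewrite Nz ler_pdivrMr ?b_gt0 // mul1r.
    by rewrite -subr_ge0 opprK.
  - under eq_bigr do rewrite of_crdK.
    by rewrite big_split /= b1 tangent_blk addr0.
  - by rewrite of_crdK tangent_supp // bS // addr0.
split => //; apply: contrapT => nz; have : gauge z < 1; last by rewrite Nz ltxx.
apply: bigmax_lt => // a aS; rewrite ltr_pdivrMr ?b_gt0 // mul1r -subr_gt0 opprK.
rewrite lt_def; have [za _ _] := Sz; have := za a; rewrite of_crdK => ->.
rewrite andbT; apply/eqP => za0; apply: nz; exists a => //.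
by rewrite of_crdK.
Qed.

End Coordinates.

Lemma cell_extension (Y : topologicalType) (n : nat) S (f : 'rV[R]_#|A| -> Y) :
  pred_connected R n Y -> (#|S| <= n + #|I|)%N ->
  {within boundary S, continuous f} ->
  exists2 h : 'rV[R]_#|A| -> Y,
    {within cell S, continuous h} & forall w, boundary S w -> h w = f w.
Proof.
move=> Yn Sn fc.
(* Without a point positive on all of [S], the cell equals its boundary and [f] itself is the
   extension. Otherwise such a point serves as the centre of the gauge. *)
have [[b [Sb b0]]|nb] :=
    pselect (exists b, cell S b /\ forall a, a \in S -> crd b a != 0); last first.
  exists f => //; apply: continuous_subspaceW fc => w Sw; split => //.
  apply: contrapT => nw; apply: nb; exists w; split => // a aS.
  by apply/eqP => wa; apply: nw; exists a.
(* A block sum of 1 forces [S] to meet every block, which supplies the representatives. *)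
have rex i : exists a, a \in S /\ blk a = i.
  apply: contrapT => ni; case: Sb => _ /(_ i) + bS; rewrite big1.
    by move/eqP; rewrite eq_sym oner_eq0.
  move=> a /eqP ai; apply: bS; apply/negP => aS; apply: ni; by exists a.
have [r rP] := choice rex.
have rS i : r i \in S by case: (rP i).
have rK : cancel r blk by move=> i; case: (rP i).
have dn : (#|free_crd S r| <= n)%N.
  by rewrite -(leq_add2r #|I|) (card_free_crd rS rK).
apply: (gauge_extension Yn dn (local_crd_continuous (b := b) (r := r))
  (local_param_continuous (b := b) (r := r))
  (gauge_continuous (b := b) (r := r))) fc.
- exact: gaugeZ.
- exact: gauge_gt0.
- exact: gauge_cell.
- exact: boundary_local_param.
- exact: gauge_boundary.
Qed.

End ProductOfSimplices.

(** * Equivariant maps from the deleted product *)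

Section DeletedProduct.
Variables (R : realType) (gT : finGroupType) (k : nat).
Local Notation A := (gT * 'I_k)%type.
Local Notation blk := (fun a : A => a.1).
Implicit Types (w : 'rV[R]_#|{: A}|) (S : {set A}) (a : A) (g h : gT).

Definition index_act a h : A := ((a.1 * h)%g, a.2).

Lemma index_actM a g h : index_act (index_act a g) h = index_act a (g * h)%g.
Proof. by rewrite /index_act mulgA. Qed.

Lemma index_act1 a : index_act a 1%g = a.
Proof. by case: a => g i; rewrite /index_act mulg1. Qed.

Lemma index_act_inj h : injective (index_act^~ h).
Proof. by move=> [g i] [g' i'] [/mulIg -> ->]. Qed.

Definition point_act w h : 'rV[R]_#|{: A}| :=
  of_crd (fun a => crd w (index_act a h^-1%g)).

Lemma crd_act w h a : crd (point_act w h) a = crd w (index_act a h^-1%g).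
Proof. exact: of_crdK. Qed.

Lemma point_actM w g h : point_act (point_act w g) h = point_act w (g * h)%g.
Proof. by apply: crd_inj => a; rewrite !crd_act index_actM invMg. Qed.

Lemma point_act_continuous h : continuous (point_act^~ h).
Proof. by apply: of_crd_continuous => a; exact: crd_continuous. Qed.

Definition set_act S h : {set A} := [set a | index_act a h^-1%g \in S]%SET.

Lemma set_actE S h a : (a \in set_act S h) = (index_act a h^-1%g \in S).
Proof. by rewrite inE. Qed.

Lemma set_actM S g h : set_act (set_act S g) h = set_act S (g * h)%g.
Proof. by apply/setP => a; rewrite !set_actE index_actM invMg. Qed.

Lemma card_set_act S h : #|set_act S h| = #|S|.
Proof. exact: (card_preimset _ (@index_act_inj h^-1%g)). Qed.

Lemma cell_act S w h : cell blk S w -> cell blk (set_act S h) (point_act w h).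
Proof.
move=> [w0 w1 wS]; split=> [a|g|a].
- by rewrite crd_act.
- rewrite -(w1 (g * h^-1)%g) (reindex_inj (@index_act_inj h)) /=.
  apply: eq_big => [a|a _]; first by rewrite (can2_eq (mulgK h) (mulgKV h)).
  by rewrite crd_act index_actM mulgV index_act1.
- by rewrite set_actE crd_act; exact: wS.
Qed.

Lemma boundary_act S w h :
  boundary blk S w -> boundary blk (set_act S h) (point_act w h).
Proof.
move=> [Sw [a aS wa]]; split; first exact: cell_act.
exists (index_act a h); first by rewrite set_actE index_actM mulgV index_act1.
by rewrite crd_act index_actM mulgV index_act1.
Qed.

Definition support w : {set A} := [set a | crd w a != 0]%SET.

Lemma supportE w a : (a \in support w) = (crd w a != 0).
Proof. by rewrite inE. Qed.

Lemma support_act w h : support (point_act w h) = set_act (support w) h.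
Proof. by apply/setP => a; rewrite set_actE !supportE crd_act. Qed.

Lemma cell_support S w : cell blk S w -> cell blk (support w) w.
Proof.
by move=> [w0 w1 _]; split=> // a; rewrite supportE negbK => /eqP.
Qed.

Lemma support_sub S w : cell blk S w -> support w \subset S.
Proof.
move=> [_ _ wS]; apply/fintype.subsetP => a; rewrite supportE.
by apply: contraNT => /wS ->.
Qed.

Lemma support_neq0 S w : cell blk S w -> exists a, a \in support w.
Proof.
move=> [_ /(_ 1%g) w1 _]; apply: contrapT => nw; move: w1; rewrite big1.
  by move/eqP; rewrite eq_sym oner_eq0.
move=> a _; apply/eqP; apply: contrapT => /negP wa; apply: nw.
by exists a; rewrite supportE.
Qed.

(* The cells of the deleted product: no color is shared by two blocks. *)
Definition separated S : Prop :=
  forall i g g', (g, i) \in S -> (g', i) \in S -> g = g'.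

Lemma separated_sub S S' : S \subset S' -> separated S' -> separated S.
Proof. by move=> /fintype.subsetP SS' S's i g g' /SS' gi /SS' /(S's _ _ _ gi). Qed.

Lemma separated_act S h : separated S -> separated (set_act S h).
Proof.
by move=> Ss i g g'; rewrite !set_actE => /Ss + g'i => /(_ _ g'i) /mulIg.
Qed.

(** Separation makes the projection to colors injective on [S]. *)
Lemma card_separated S : separated S -> (#|S| <= k)%N.
Proof.
move=> Ss; rewrite -[leqRHS]card_ord -(card_in_imset (f := snd) (D := mem S)).
  exact: max_card.
by move=> [g i] [g' i'] /= gi g'i ii'; rewrite -ii' in g'i *; rewrite (Ss i g g').
Qed.

(* The block of the first color in S; it selects the cell translated by its
   inverse as the representative of the orbit of S. *)
Definition lead S : gT :=
  if [pick i | [exists g, (g, i) \in S]] is Some i then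
    odflt 1%g [pick g | (g, i) \in S]
  else 1%g.

(** Translation keeps the colors, hence the first color; by separation its block is unique, and it
    is moved by [h]. *)
Lemma lead_act S a h :
  separated S -> a \in S -> lead (set_act S h) = (lead S * h)%g.
Proof.
move=> Ss aS; rewrite /lead.
have -> : [pick i | [exists g, (g, i) \in set_act S h]] =
          [pick i | [exists g, (g, i) \in S]].
  apply: eq_pick => i; apply/existsP/existsP => -[g]; rewrite ?set_actE.
    by exists (g * h^-1)%g.
  by move=> gi; exists (g * h)%g; rewrite set_actE /index_act /= mulgK.
case: pickP => [i /existsP[g gi]|/(_ a.2)]; last first.
  by move=> /negbT/existsPn/(_ a.1); rewrite -surjective_pairing aS.
case: pickP => [g1|/(_ (g * h)%g)]; rewrite set_actE /index_act /=; last first.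
  by rewrite mulgK gi.
case: pickP => [g2 g2i|/(_ g)]; last by rewrite gi.
by move=> /(Ss _ _ _ g2i) /= ->; rewrite mulgKV.
Qed.

(** * Equivariant extension over the skeleta *)

Section Extension.
Variables (Y : Gspace gT) (n : nat).
Hypotheses (Yn : pred_connected R n Y) (kn : (k <= n + #|gT|)%N).

(** The induction hypothesis over skeleta; [F] is total, with arbitrary values off the cells
    considered. *)
Definition skeleton_map m (F : 'rV[R]_#|{: A}| -> Y) : Prop :=
  forall S, separated S -> (#|S| <= m)%N ->
    {within cell blk S, continuous F} /\
    forall w h, cell blk S w -> F (point_act w h) = space_act Y (F w) h.

(** The boundary lies in the finite union of the closed cells on [S :\ a], where [F] is already
    continuous, and [|S| <= k <= n + |G|] bounds the dimension by [n]. *)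
Lemma extend_cell m F S : skeleton_map m F -> separated S -> (#|S| = m.+1)%N ->
  exists2 f : 'rV[R]_#|{: A}| -> Y, {within cell blk S, continuous f} &
    forall w, boundary blk S w -> f w = F w.
Proof.
move=> Fm Ss Sm; apply: (cell_extension Yn).
  exact: leq_trans (card_separated Ss) kn.
apply: (@continuous_subspaceW _ _ _
    (\big[setU/set0]_(a <- enum S) cell blk (S :\ a))).
  move=> w /boundary_sub[a aS Saw]; rewrite -bigcup_seq; exists a => //=.
  by rewrite mem_enum.
apply: within_continuous_bigsetU => [a|a]; first exact: closed_cell.
rewrite mem_enum => aS; apply: (Fm _ _ _).1.
  exact: separated_sub (finset.subD1set _ _) Ss.
by move: Sm; rewrite (cardsD1 a) aS add1n => -[->].
Qed.

Lemma extend_skeleton m F : skeleton_map m F -> exists F', skeleton_map m.+1 F'.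
Proof.
move=> Fm.
have /choice[ext extP] (S : {set A}) : exists f : 'rV[R]_#|{: A}| -> Y,
    separated S -> (#|S| = m.+1)%N -> {within cell blk S, continuous f} /\
    forall w, boundary blk S w -> f w = F w.
  have [[Ss Sm]|nS] := pselect (separated S /\ #|S| = m.+1).
    by have [f fc fF] := extend_cell Fm Ss Sm; exists f.
  by exists F => Ss Sm; case: nS.
(* Carry [w] to the orbit representative of its cell, apply the extension chosen there, and carry
   the value back. *)
pose ext_act S w := space_act Y
  (ext (set_act S (lead S)^-1%g) (point_act w (lead S)^-1%g)) (lead S).
(* The support indexes the cell having [w] in its relative interior. *)
pose F' w := if (#|support w| <= m)%N then F w else ext_act (support w) w.
have F'F S w : (#|S| <= m)%N -> cell blk S w -> F' w = F w.
  move=> Sm /support_sub/subset_leq_card wS.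
  by rewrite /F' (leq_trans wS Sm).
have F'ext S w : separated S -> (#|S| = m.+1)%N -> cell blk S w ->
    F' w = ext_act S w.
  move=> Ss Sm Sw; rewrite /F'; have wS := support_sub Sw.
  (* Either the support is all of [S], or [w] lies on the boundary, where the extension equals [F]
     and equivariance of [F] cancels the two translations. *)
  have [wm|wm] := leqP; last first.
    congr ext_act; apply/eqP; rewrite eqEcard wS Sm; exact: wm.
  have bw : boundary blk S w.
    split => //; have /subsetPn[a aS wa] : ~~ (S \subset support w).
      by apply: contraL wm => /subset_leq_card; rewrite Sm -ltnNge.
    by exists a => //; move: wa; rewrite supportE negbK => /eqP.
  rewrite /ext_act (extP _ _ _).2.
  - rewrite ((Fm _ (separated_sub wS Ss) wm).2 _ _ (cell_support Sw)).
    by rewrite total_actKV.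
  - exact: separated_act.
  - by rewrite card_set_act.
  - exact: boundary_act.
exists F' => S Ss Sm; split.
  move: Sm; rewrite leq_eqVlt ltnS => /orP[/eqP Sm|Sm]; last first.
    apply: within_continuous_eq (Fm _ Ss Sm).1 => w Sw.
    by rewrite (F'F S).
  apply: (within_continuous_eq (f := ext_act S)) => [w Sw|].
    by rewrite (F'ext S).
  have [ec _] := extP _ (separated_act (h := (lead S)^-1%g) Ss)
    (etrans (card_set_act _ _) Sm).
  have pc : {within cell blk S, continuous point_act^~ (lead S)^-1%g}.
    by apply: continuous_subspaceT; exact: point_act_continuous.
  have epc := within_continuous_comp (fun w => @cell_act S w (lead S)^-1%g) pc ec.
  have sc : {within setT, continuous (fun y : Y => space_act Y y (lead S))}.
    by apply: continuous_subspaceT; exact: space_act_continuous.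
  exact: (within_continuous_comp (fun _ _ => Logic.I) epc sc).
move=> w h Sw; have wS := support_sub Sw; have Ts := separated_sub wS Ss.
have Tw := cell_support Sw.
have Tm := leq_trans (subset_leq_card wS) Sm.
have Thw : cell blk (set_act (support w) h) (point_act w h) by exact: cell_act.
move: Tm; rewrite leq_eqVlt ltnS => /orP[/eqP Tm|Tm]; last first.
  rewrite (F'F _ _ _ Thw) ?card_set_act // (F'F _ _ Tm Tw).
  exact: (Fm _ Ts Tm).2.
rewrite (F'ext _ _ _ _ Thw) ?card_set_act //; last exact: separated_act.
rewrite (F'ext _ _ Ts Tm Tw) /ext_act.
have [a aw] := support_neq0 Sw.
(* Both cells of the orbit have the same representative, so both sides use the same extension at the
   same point. *)
rewrite (lead_act _ Ts aw) set_actM point_actM invMg mulKVg.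
exact: total_actM.
Qed.

Lemma skeleton_map_exists m : exists F, skeleton_map m F.
Proof.
elim: m => [|m [F /extend_skeleton//]].
have [[y0] _] := Yn; exists (fun=> y0) => S Ss.
rewrite leqn0 cards_eq0 => /eqP S0.
(* The induction starts with the empty vertex set, whose cell has no points. *)
have nS w : ~ cell blk S w.
  move=> Sw; have [a] := support_neq0 Sw.
  by move/(fintype.subsetP (support_sub Sw)); rewrite S0 inE.
split=> [|w h /nS//].
by apply: continuous_subspaceT; exact: (@cst_continuous _ _ y0).
Qed.

Definition deleted_product : set 'rV[R]_#|{: A}| :=
  [set w | exists2 S, separated S & cell blk S w].

Lemma deleted_product_map : exists F : 'rV[R]_#|{: A}| -> Y,
  {within deleted_product, continuous F} /\
  forall w h, deleted_product w -> F (point_act w h) = space_act Y (F w) h.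
Proof.
have [F Fk] := skeleton_map_exists k; exists F; split; last first.
  by move=> w h [S Ss]; exact: (Fk _ Ss (card_separated Ss)).2.
apply: (@continuous_subspaceW _ _ _
  (\big[setU/set0]_(S <- [seq S <- enum {set A} | `[< separated S >]]) cell blk S)).
  move=> w [S Ss Sw]; rewrite -bigcup_seq; exists S => //=.
  by rewrite mem_filter mem_enum andbT; exact/asboolP.
apply: within_continuous_bigsetU => [S|S]; first exact: closed_cell.
rewrite mem_filter => /andP[/asboolP Ss _].
exact: (Fk _ Ss (card_separated Ss)).1.
Qed.

End Extension.
End DeletedProduct.

(** * The map defined by a coloring *)

(** On a closed simplex the coordinate is either controlled by the sup metric or identically 0. *)
Lemma realization_coord_continuous (R : realType) (K : simplicial_complex)
  (v : vertex K) : continuous (fun x : realization R K => Defs.coord x v).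
Proof.
apply/continuousP => U oU; apply/realization_openE => s x Ks [_ xs _] Ux.
have /nbhs_ballP[e /= e0 eU] : nbhs (Defs.coord x v) U by apply: open_nbhs_nbhs.
exists e => // y [_ ys _] xy; apply: eU.
have [vs|vs] := boolP (v \in s); first exact: xy.
by rewrite /ball /= xs // ys // subrr normr0.
Qed.

Section ColorMap.
Variables (R : realType) (gT : finGroupType) (d : Order.disp_t).
Variables (P : finPOrderType d) (to : {action gT &-> P}).
Variables (to_lt : order_preserving to) (k : nat) (c : P -> 'I_k).
Hypothesis c_compat : forall x y, compat_graph to x y -> c x != c y.
Local Notation X := (realization_Gspace R (order_Gcomplex to_lt)).

Definition color_mass (x : X) (a : gT * 'I_k) : R :=
  \sum_(p : P | c (to p a.1^-1%g) == a.2) Defs.coord x p.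

Definition color_map (x : X) : 'rV[R]_#|{: gT * 'I_k}| := of_crd (color_mass x).

Lemma color_map_continuous : continuous color_map.
Proof.
apply: of_crd_continuous => a; apply: continuous_sumr => p _.
exact: (@realization_coord_continuous R (order_Gcomplex to_lt) p).
Qed.

Lemma color_map_act x g : color_map (space_act X x g) = point_act (color_map x) g.
Proof.
apply: crd_inj => a; rewrite crd_act !of_crdK /color_mass.
rewrite (reindex_inj (@total_act_inj _ _ to g)) /=.
apply: eq_big => [p|p _]; first by rewrite -total_actM invMg invgK.
by rewrite /coord_act /= total_actK.
Qed.

Lemma realization_ge0 (x : X) (p : P) : 0 <= Defs.coord x p.
Proof. by have [s _ [x0 _ _]] := Defs.coordP x; exact: x0. Qed.

Lemma realization_sum1 (x : X) : \sum_(p : P) Defs.coord x p = 1.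
Proof.
have [s _ [_ xs <-]] := Defs.coordP x.
rewrite [RHS](big_uniq _ (fset_uniq s)) [RHS]big_mkcond /=; apply: eq_bigr => p _.
by case: ifPn => // ps; exact: xs.
Qed.

Lemma realization_comparable (x : X) (p q : P) :
  Defs.coord x p != 0 -> Defs.coord x q != 0 -> (p >=< q)%O.
Proof.
have [s [_ sc] [_ xs _]] := Defs.coordP x => xp xq.
apply: sc; [apply: contraNT xp | apply: contraNT xq] => /xs -> //.
Qed.

Lemma color_map_deleted_product x : deleted_product (color_map x).
Proof.
have mass_neq0 a : crd (color_map x) a != 0 ->
    exists2 p : P, Defs.coord x p != 0 & c (to p a.1^-1%g) = a.2.
  rewrite of_crdK => xa; apply: contrapT => np; case/eqP: xa.
  apply: big1 => p /eqP pa; apply/eqP; apply: contrapT => /negP xp.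
  by apply: np; exists p.
exists (support (color_map x)); last first.
  (* Sign and block sums do not involve the vertex set, so they are checked in the full product; for
     fixed [g] the sum over colors recovers the total mass 1. *)
  apply: (cell_support (S := [set: gT * 'I_k]%SET)).
  split=> [a|g|a]; last by rewrite inE.
    by rewrite of_crdK; apply: sumr_ge0 => p _; exact: realization_ge0.
  rewrite -(realization_sum1 x).
  rewrite (partition_big (fun p => c (to p g^-1%g)) predT) //=.
  rewrite (reindex (fun i => (g, i))) /=; last first.
    exists snd => [i _|[h i]] //; rewrite inE /= => /eqP -> //.
  by apply: eq_big => [i|i _]; rewrite ?eqxx // of_crdK.
move=> i g h; rewrite !supportE => /mass_neq0[p xp /= pi] /mass_neq0[q xq /= qi].
apply/eqP; apply: contrapT => /negP gh.
have : compat_graph to (to p g^-1%g) (to q h^-1%g).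
  (* This element takes [to q h^-1] to [to q g^-1], which is comparable to [to p g^-1] because [p]
     and [q] lie in a common chain. *)
  apply/existsP; exists (h * g^-1)%g; rewrite -eq_mulgV1 eq_sym gh /=.
  rewrite total_actM total_actKV; apply: (order_preserving_comparable to_lt).
  exact: realization_comparable xp xq.
by move=> /c_compat; rewrite pi qi eqxx.
Qed.

(** The orbit of any element is a clique of the compatibility graph, so its [|G|] translates need
    distinct colors. *)
Lemma card_group_le : (0 < #|P|)%N -> (#|gT| <= k)%N.
Proof.
move=> /card_gt0P[p _]; rewrite -[leqRHS]card_ord.
apply: (@leq_card _ _ (fun g => c (to p g))) => g h cgh.
apply/eqP; apply: contrapT => /negP gh.
have : compat_graph to (to p g) (to p h).
  apply/existsP; exists (h^-1 * g)%g; rewrite -total_actM mulKVg comparablexx andbT.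
  by rewrite -eq_invg_mul invgK eq_sym.
by move=> /c_compat; rewrite cgh eqxx.
Qed.

Lemma color_G_map (Y : Gspace gT) (n : nat) :
  pred_connected R n Y -> (k <= n + #|gT|)%N -> exists f : X -> Y, G_map f.
Proof.
move=> Yn kn; have [F [Fc Fa]] := deleted_product_map Yn kn.
exists (F \o color_map); split; last first.
  by move=> x g; rewrite /= color_map_act Fa //; exact: color_map_deleted_product.
apply/continuous_subspace_setT.
apply: within_continuous_comp Fc.
  by move=> x _; exact: color_map_deleted_product.
by apply: continuous_subspaceT; exact: color_map_continuous.
Qed.

End ColorMap.

(* The bound on the index *)
Local Close Scope ring_scope.
Local Close Scope classical_set_scope.

Theorem theorem8 (R : realType) (gT : finGroupType)
    (E : forall n : nat, EG_space R gT n)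
    (gT_nontrivial : 1 < #|gT|)
    (d : Order.disp_t) (P : finPOrderType d) (to : {action gT &-> P})
    (P_nonempty : 0 < #|P|)
    (to_lt : order_preserving to) (to_free : free_action to) :
  exists n : nat,
    is_G_index E (realization_Gspace R (order_Gcomplex to_lt)) n /\
    n + #|gT| <= chromatic_number (compat_graph to).
Proof.
set X := realization_Gspace R (order_Gcomplex to_lt).
set k := chromatic_number (compat_graph to).
have /existsP[c /forallP c_proper] : colorable (compat_graph to) k.
  by apply: chromatic_number_colorable; exact: compat_graph_irreflexive.
have c_compat x y : compat_graph to x y -> c x != c y.
  by move=> xy; move/forallP: (c_proper x) => /(_ y); rewrite xy.
(* This makes the truncated subtraction [k - #|gT|] exact. *)
have gk : #|gT| <= k := card_group_le c_compat P_nonempty.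
pose maps m := `[< exists f : X -> EG_Gspace (E m), G_map f >].
have ex_maps : maps (k - #|gT|).
  apply/asboolP; pose Y := EG_Gspace (E (k - #|gT|)).
  by apply: (color_G_map (Y := Y) to_lt c_compat (EG_connected _)); rewrite subnK.
(* The index is the least target dimension, hence at most [k - #|gT|]. *)
case: (ex_minnP (ex_intro maps _ ex_maps)) => n /asboolP nf n_min.
exists n; split; first by split => // m mf; apply: n_min; exact/asboolP.
by rewrite -[leqRHS](subnK gk) leq_add2r n_min.
Qed.
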